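(* Consider the equation $V_2(y)=a\,V_1(x)$ in $W(\varpi_1)$, where $x=(x_0,\dots,x_5)$ is given and the unknowns are the scalar $a$ and $y=(y_0,\dots,y_5)$, to be found as rational functions of $x$. It has a unique solution, given by $$a(x)=\frac{1}{x_0x_1x_2x_3^2x_4}\big(x_0x_2x_3x_4+x_2x_3^2x_4+x_1x_3^3x_4+x_1x_2x_4^2+x_0x_2x_3^2x_5+x_0x_1x_3^3x_5+2x_1x_2x_3x_4x_5+x_1x_2x_3^2x_5^2\big),$$ $$y_0=a(x)x_0,\qquad y_1=\frac{P}{x_0x_1x_2^2x_3^3x_4},$$ $$y_2=\frac{x_2}{x_1^3}+\frac{3x_3}{x_1^2}+\frac{x_3^3}{x_2^2}+\frac{(x_4+x_3x_5)^3}{x_3^3x_4}+\frac{2x_4+3x_3x_5}{x_2}+\frac{3(x_3^3+x_2x_4+x_2x_3x_5)}{x_1x_2x_3},$$ $$y_3=\frac{QR}{x_0^2P},\qquad y_4=\frac{R^3}{S},\qquad y_5=\frac{x_0x_5R}{x_4Q},$$ where \begin{align*} P={}&x_1^2x_3^6x_4+x_1x_2x_3^3x_4(2x_3^2+2x_1x_4+3x_1x_3x_5)\\ &+x_2^2\big(x_3^4x_4+x_1^2x_4^3+3x_1^2x_3x_4^2x_5+x_1x_3^3x_5(2x_4+x_1x_5^2)+x_1x_3^2x_4(2x_4+3x_1x_5^2)\big)\\ &+x_0x_2x_3\big(x_1x_3^3x_4+x_2(x_1x_4^2+2x_1x_3x_4x_5+x_3^2(x_4+x_1x_5^2))\big),\\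 Q={}&x_0^2x_2x_3+x_1x_2x_3^2x_5+x_0\big(x_1x_3^3+x_2(x_3^2+x_1x_4+x_1x_3x_5)\big),\\ R={}&x_1x_3^3x_4+x_0x_3\big(x_1x_3^2x_5+x_2(x_4+x_3x_5)\big)+x_2\big(x_1x_4^2+2x_1x_3x_4x_5+x_3^2(x_4+x_1x_5^2)\big),\\ S={}&x_0^3x_3^3x_4\Big(x_2^3x_3^3x_4+x_1^3x_3^6x_4+x_1^2x_2x_3^3x_4(3x_3^2+2x_1x_4+3x_1x_3x_5)\\ &+x_1x_2^2\big(3x_3^4x_4+x_1^2x_4^3+3x_1^2x_3x_4^2x_5+3x_1x_3^2x_4(x_4+x_1x_5^2)+x_1x_3^3x_5(3x_4+x_1x_5^2)\big)\Big). \end{align*} Furthermore, the morphism $\overline\sigma:\mathcal V_1\to\mathcal V_2$, $V_1(x_0,\dots,x_5)\mapsto V_2(y_0,\dots,y_5)$, given by these formulas is a bi-positive birational isomorphism; that is, it is positive and there exists an inverse positive rational map $\overline\sigma^{-1}:\mathcal V_2\to\mathcal V_1$, $V_2(y)\mapsto V_1(x)$, which is given by $$x_0=\frac1{y_3}+\frac{y_5}{y_0}+\frac{y_3y_5}{y_4}+\frac{\frac{y_0}{y_3}+y_5}{y_1},$$ $$x_1=\frac1{y_0}\left(1+\frac{y_3^2y_5}{y_4}+\frac{y_4\left(\frac{y_0}{y_3}+y_5\right)}{y_1^2}+\frac{y_0+2y_3y_5}{y_1}+\frac{y_1\left(\frac{y_0}{y_3}+y_5+\frac{y_0y_3y_5}{y_4}\right)}{y_2}\right),$$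 $$x_2=\frac{T}{y_0^3y_1^6y_2y_3^3y_4^3},\quad x_3=\frac{UV}{W},\quad x_4=\frac{y_1^3y_2^2y_4U^3}{y_0^3T},\quad x_5=\frac{y_1^2y_2y_4y_5U}{y_0V},$$ where \begin{align*} T={}&y_0^3y_4^3\big(y_1^6y_4+3y_1^4y_2y_3y_4+3y_1^2y_2^2y_3^2y_4+3y_1y_2^2y_3y_4^2+y_2^2y_4^3+y_1^3y_2(y_2y_3^3+2y_4^2)\big)\\ &+3y_0^2y_3y_4^2\big(y_1^2y_2y_3^2+y_1^3y_4+2y_1y_2y_3y_4+y_2y_4^2\big)\\ &\quad\times\big(y_1^3y_4y_5+2y_1y_2y_3y_4y_5+y_2y_4^2y_5+y_1^2y_2(y_4+y_3^2y_5)\big)\\ &+y_3^3\Big(6y_1y_2^2y_3y_4^5y_5^3+y_2^2y_4^6y_5^3+3y_1^2y_2^2y_4^4y_5^2(y_4+5y_3^2y_5)\\ &\quad+2y_1^3y_2y_4^3y_5^2(6y_2y_3y_4+10y_2y_3^3y_5+y_4^2y_5)\\ &\quad+3y_1^5y_2y_4y_5\big(2y_2y_3(y_4+y_3^2y_5)^2+y_4^2y_5(y_4+2y_3^2y_5)\big)\\ &\quad+y_1^6\big(y_4^4y_5^3+y_2^2(y_4+y_3^2y_5)^3+y_2y_3y_4^2y_5^2(3y_4+2y_3^2y_5)\big)\\ &\quad+3y_1^4y_2y_4^2y_5\big(2y_3y_4^2y_5^2+y_2(y_4^2+6y_3^2y_4y_5+5y_3^4y_5^2)\big)\Big)\\ &+3y_0y_3^2y_4\Big(5y_1y_2^2y_3y_4^4y_5^2+y_2^2y_4^5y_5^2+2y_1^2y_2^2y_4^3y_5(y_4+5y_3^2y_5)\\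 &\quad+2y_1^3y_2y_4^2y_5(3y_2y_3y_4+5y_2y_3^3y_5+y_4^2y_5)\\ &\quad+y_1^6y_4y_5\big(y_4^2y_5+y_2y_3(y_4+y_3^2y_5)\big)\\ &\quad+y_1^5y_2\big(y_2y_3(y_4+y_3^2y_5)^2+2y_4^2y_5(y_4+2y_3^2y_5)\big)\\ &\quad+y_1^4y_2y_4\big(5y_3y_4^2y_5^2+y_2(y_4^2+6y_3^2y_4y_5+5y_3^4y_5^2)\big)\Big),\\ U={}&y_0^2y_4+y_1y_3y_4y_5+y_0\big(y_3y_4y_5+y_1(y_4+y_3^2y_5)\big),\\ V={}&3y_1y_2y_3^2y_4^2y_5^2+y_2y_3y_4^3y_5^2+y_1^2y_2y_3y_4y_5(2y_4+3y_3^2y_5)\\ &+y_0y_4\big(y_1^3y_4y_5+2y_1y_2y_3y_4y_5+y_2y_4^2y_5+y_1^2y_2(y_4+y_3^2y_5)\big)\\ &+y_1^3\big(y_3y_4^2y_5^2+y_2(y_4+y_3^2y_5)^2\big),\\ W={}&y_0^2y_1y_4^2\Big(y_0\big(y_1y_2y_3y_4+y_2y_4^2+y_1^3(y_4+y_3^2y_5)\big)\\ &+y_3\big(y_1^3y_4y_5+2y_1y_2y_3y_4y_5+y_2y_4^2y_5+y_1^2y_2(y_4+y_3^2y_5)\big)\Big). \end{align*}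
   Context: Let $\mathfrak g$ be the affine Lie algebra of type $D_4^{(3)}$ with index set $I=\{0,1,2\}$, Cartan matrix $A=(a_{ij})_{i,j\in I}$, $a_{ij}=\alpha_j(\alpha_i^\vee)$, $$A=\begin{pmatrix}2&-1&0\\-1&2&-3\\0&-1&2\end{pmatrix},$$ Chevalley generators $e_i,f_i$, simple coroots $\alpha_i^\vee$, and fundamental weights $\Lambda_i$ with $\langle\alpha_i^\vee,\Lambda_j\rangle=\delta_{ij}$. The fundamental representation $W(\varpi_1)$ is the 8-dimensional complex $\mathfrak g$-module with basis $\{v_1,v_2,v_3,v_0,\emptyset,v_{\bar3},v_{\bar2},v_{\bar1}\}$ of weight vectors, with weights $\mathrm{wt}(v_1)=\Lambda_1-2\Lambda_0$, $\mathrm{wt}(v_2)=-\Lambda_0-\Lambda_1+\Lambda_2$, $\mathrm{wt}(v_3)=-\Lambda_0+2\Lambda_1-\Lambda_2$, $\mathrm{wt}(v_{\bar i})=-\mathrm{wt}(v_i)$ ($i=1,2,3$), $\mathrm{wt}(v_0)=\mathrm{wt}(\emptyset)=0$. The nonzero actions of the $f_i$ on basis vectors are: - $f_0v_0=v_1$, $f_0v_{\bar3}=v_2$, $f_0v_{\bar2}=v_3$, $f_0v_{\bar1}=\emptyset+\tfrac12v_0$, $f_0\emptyset=\tfrac32v_1$; - $f_1v_1=v_2$, $f_1v_3=v_0$, $f_1v_0=2v_{\bar3}$, $f_1v_{\bar2}=v_{\bar1}$; - $f_2v_2=v_3$, $f_2v_{\bar3}=v_{\bar2}$; all other $f_i$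 applied to basis vectors give $0$. For $c\in\mathbb C^\times$ let $\alpha_i^\vee(c)$ act on a weight vector $v$ by $\alpha_i^\vee(c)v=c^{\langle\alpha_i^\vee,\mathrm{wt}(v)\rangle}v$, and put $Y_i(c)=\exp(c^{-1}f_i)\,\alpha_i^\vee(c)$. Define, for $x,y\in(\mathbb C^\times)^6$, $$V_1(x)=Y_0(x_0)Y_1(x_1)Y_2(x_2)Y_1(x_3)Y_2(x_4)Y_1(x_5)v_1,$$ $$V_2(y)=Y_2(y_2)Y_1(y_1)Y_2(y_4)Y_1(y_3)Y_0(y_0)Y_1(y_5)v_{\bar2},$$ and $\mathcal V_1=\{V_1(x)\mid x\in(\mathbb C^\times)^6\}$, $\mathcal V_2=\{V_2(y)\mid y\in(\mathbb C^\times)^6\}$, subsets of $W(\varpi_1)$. Rational maps between $\mathcal V_1$ and $\mathcal V_2$ are expressed in the coordinates $x$ and $y$. A nonzero rational function on an algebraic torus is positive if it can be written as $g/h$ with $g,h$ positive linear combinations of characters (Laurent monomials). A rational map between tori is positive if its composition with every character of the target is positive. *)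

(* Defs.v *)
From HB Require Import structures.
From mathcomp Require Import all_boot all_order all_algebra.
From mathcomp Require Import fraction complex reals.
From mathcomp Require Import mpoly.

Set Implicit Arguments.
Unset Strict Implicit.
Unset Printing Implicit Defensive.

Import Order.TTheory GRing.Theory Num.Theory.
Local Open Scope ring_scope.

Notation i0 := (@Ordinal 3 0 isT).
Notation i1 := (@Ordinal 3 1 isT).
Notation i2 := (@Ordinal 3 2 isT).

Notation c0 := (@Ordinal 6 0 isT).
Notation c1 := (@Ordinal 6 1 isT).
Notation c2 := (@Ordinal 6 2 isT).
Notation c3 := (@Ordinal 6 3 isT).
Notation c4 := (@Ordinal 6 4 isT).
Notation c5 := (@Ordinal 6 5 isT).

(* Basis of W(varpi_1), in the order v1, v2, v3, v0, emptyset, v3bar, v2bar,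
   v1bar. *)
Notation bv1 := (@Ordinal 8 0 isT).
Notation bv2 := (@Ordinal 8 1 isT).
Notation bv3 := (@Ordinal 8 2 isT).
Notation bv0 := (@Ordinal 8 3 isT).
Notation bvE := (@Ordinal 8 4 isT).
Notation bv3b := (@Ordinal 8 5 isT).
Notation bv2b := (@Ordinal 8 6 isT).
Notation bv1b := (@Ordinal 8 7 isT).

(* The affine Cartan matrix of type D_4^(3): a_ij = <alpha_i^vee, alpha_j>. *)
Definition cartan : 'M[int]_3 :=
  \matrix_(i, j) nth 0 (nth [::] [:: [:: 2; -1; 0];
                                     [:: -1; 2; -3];
                                     [:: 0; -1; 2]] i) j.

(* Weights are recorded modulo the null root, i.e. by their coordinates on
   Lambda_0, Lambda_1, Lambda_2; these are their values on the coroots. *)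
Definition Lam (i : 'I_3) : 'rV[int]_3 := delta_mx 0 i.
Definition pairing (i : 'I_3) (lam : 'rV[int]_3) : int := lam 0 i.
Definition alpha (j : 'I_3) : 'rV[int]_3 := \sum_i cartan i j *: Lam i.

Definition wt : 'I_8 -> 'rV[int]_3 := tnth [tuple
  Lam i1 - Lam i0 *+ 2;
  - Lam i0 - Lam i1 + Lam i2;
  - Lam i0 + Lam i1 *+ 2 - Lam i2;
  0;
  0;
  - (- Lam i0 + Lam i1 *+ 2 - Lam i2);
  - (- Lam i0 - Lam i1 + Lam i2);
  - (Lam i1 - Lam i0 *+ 2)].

Section Module.
Variable F : fieldType.

(* Operators act on column vectors: [delta_mx t s] sends the basis vector s
   to t. *)
Definition f0 : 'M[F]_8 :=
  delta_mx bv1 bv0 + delta_mx bv2 bv3b + delta_mx bv3 bv2b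
  + (delta_mx bvE bv1b + 2^-1 *: delta_mx bv0 bv1b)
  + (3 / 2) *: delta_mx bv1 bvE.

Definition f1 : 'M[F]_8 :=
  delta_mx bv2 bv1 + delta_mx bv0 bv3 + 2 *: delta_mx bv3b bv0
  + delta_mx bv1b bv2b.

Definition f2 : 'M[F]_8 := delta_mx bv3 bv2 + delta_mx bv2b bv3b.

Definition f : 'I_3 -> 'M[F]_8 := tnth [tuple f0; f1; f2].

Definition bvec (b : 'I_8) : 'cV[F]_8 := delta_mx b 0.

(* The exponential series of a nilpotent matrix of size n + 1 stops before
   exponent n + 1. *)
Definition nexp n (A : 'M[F]_n.+1) : 'M[F]_n.+1 :=
  \sum_(k < n.+1) (k`!%:R)^-1 *: A ^+ k.

Definition coroot_act (i : 'I_3) (c : F) : 'M[F]_8 :=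
  diag_mx (\row_b c ^ pairing i (wt b)).

Definition Y (i : 'I_3) (c : F) : 'M[F]_8 :=
  nexp (c^-1 *: f i) *m coroot_act i c.

End Module.



Lemma f_supp (F : fieldType) (i : 'I_3) (t s : 'I_8) : f F i t s != 0 ->
  (t, s) \in nth [::] [::
    [:: (bv1, bv0); (bv2, bv3b); (bv3, bv2b); (bvE, bv1b); (bv0, bv1b);
        (bv1, bvE)];
    [:: (bv2, bv1); (bv0, bv3); (bv3b, bv0); (bv1b, bv2b)];
    [:: (bv3, bv2); (bv2b, bv3b)]] i.
Proof.
have addP (A B : 'M[F]_8) : (A + B) t s != 0 -> A t s != 0 \/ B t s != 0.
  rewrite mxE; case: (eqVneq (A t s) 0) => [->|]; last by left.
  by rewrite add0r; right.
have scP c (A : 'M[F]_8) : (c *: A) t s != 0 -> A t s != 0.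
  by rewrite mxE; apply: contra => /eqP->; rewrite mulr0.
have dP a b : (delta_mx a b : 'M[F]_8) t s != 0 -> t = a /\ s = b.
  rewrite mxE; case: (t =P a) => [->|_]; last by rewrite eqxx.
  by case: (s =P b) => [->|_]; last by rewrite eqxx.
case: i => [[|[|[|//]]] ip]; rewrite /f (tnth_nth 0) /= ?/f0 ?/f1 ?/f2;
repeat (lazymatch goal with
  | |- is_true (fun_of_matrix (_ + _) _ _ != 0) -> _ => case/addP
  | |- is_true (fun_of_matrix (_ *: _) _ _ != 0) -> _ => move/scP
  | |- is_true (fun_of_matrix (delta_mx _ _) _ _ != 0) -> _ =>
      case/dP => -> ->
  end); by [].
Qed.

Lemma f_cube (F : fieldType) (i : 'I_3) : f F i ^+ 3 = 0.
Proof.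
apply/matrixP => t s; rewrite [RHS]mxE; apply/eqP/negPn/negP.
have mulP (A B : 'M[F]_8) r q : (A * B) r q != 0 ->
    exists2 k, A r k != 0 & B k q != 0.
  rewrite mxE => nz; case: (pickP (fun k => A r k * B k q != 0)) => [k|z].
    by rewrite mulf_eq0 negb_or => /andP[]; exists k.
  by case/eqP: nz; rewrite big1 // => k _; apply/eqP/negbFE/z.
rewrite exprS expr2 => /mulP[a /f_supp fta /mulP[b /f_supp fab /f_supp fbs]].
move: fta fab fbs; case: i => [[|[|[|//]]] ip] /=; rewrite !inE !xpair_eqE;
repeat lazymatch goal with
  | |- is_true (_ || _) -> _ => case/orP
  | |- is_true (_ && _) -> _ => case/andP
  | |- is_true (?x == _) -> _ => first [done | move/eqP => ?; subst | move=> _]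
  end.
Qed.

Lemma f_wt (F : fieldType) (i : 'I_3) (t s : 'I_8) :
  f F i t s != 0 -> wt t = wt s - alpha i.
Proof.
have wE a b j :
    [&& pairing i0 (wt a) == pairing i0 (wt b) - cartan i0 j,
        pairing i1 (wt a) == pairing i1 (wt b) - cartan i1 j &
        pairing i2 (wt a) == pairing i2 (wt b) - cartan i2 j] ->
    wt a = wt b - alpha j.
  have aE k : alpha j 0 k = cartan k j.
    rewrite summxE (bigD1 k) //= big1 => [|l lk]; rewrite !mxE eqxx ?eqxx /=.
      by rewrite mulr1 addr0.
    by rewrite eq_sym (negbTE lk) mulr0.
  case/and3P => /eqP h0 /eqP h1 /eqP h2; apply/rowP => k.
  have -> : (wt b - alpha j) 0 k = wt b 0 k - cartan k j by rewrite mxE mxE aE.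
  case: k => [[|[|[|//]]] p]; rewrite (bool_irrelevance p isT).
  - exact: h0.
  - exact: h1.
  - exact: h2.
move/f_supp; case: i => [[|[|[|//]]] ip] /=; rewrite !inE !xpair_eqE;
repeat lazymatch goal with
  | |- is_true (_ || _) -> _ => case/orP
  | |- is_true (_ && _) -> _ => case/andP
  | |- is_true (_ == _) -> _ => move/eqP => ->
  end; apply: wE.
all: by rewrite /pairing /wt /tnth /= !mxE.
Qed.

Section Torus.
Variable F : fieldType.

Definition torus (x : 'I_6 -> F) : Prop := forall i, x i != 0.

Definition V1 (x : 'I_6 -> F) : 'cV[F]_8 :=
  Y i0 (x c0) *m (Y i1 (x c1) *m (Y i2 (x c2) *m (Y i1 (x c3) *m
    (Y i2 (x c4) *m (Y i1 (x c5) *m bvec F bv1))))).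

Definition V2 (y : 'I_6 -> F) : 'cV[F]_8 :=
  Y i2 (y c2) *m (Y i1 (y c1) *m (Y i2 (y c4) *m (Y i1 (y c3) *m
    (Y i0 (y c0) *m (Y i1 (y c5) *m bvec F bv2b))))).

Section Sigma.
Variable x : 'I_6 -> F.
Local Notation x0 := (x c0).
Local Notation x1 := (x c1).
Local Notation x2 := (x c2).
Local Notation x3 := (x c3).
Local Notation x4 := (x c4).
Local Notation x5 := (x c5).

Definition a_sol : F := (x0 * x1 * x2 * x3^+2 * x4)^-1 *
  (x0 * x2 * x3 * x4 + x2 * x3^+2 * x4 + x1 * x3^+3 * x4 + x1 * x2 * x4^+2
   + x0 * x2 * x3^+2 * x5 + x0 * x1 * x3^+3 * x5 + 2 * x1 * x2 * x3 * x4 * x5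
   + x1 * x2 * x3^+2 * x5^+2).

Definition polP : F :=
  x1^+2 * x3^+6 * x4
  + x1 * x2 * x3^+3 * x4 * (2 * x3^+2 + 2 * x1 * x4 + 3 * x1 * x3 * x5)
  + x2^+2 * (x3^+4 * x4 + x1^+2 * x4^+3 + 3 * x1^+2 * x3 * x4^+2 * x5
             + x1 * x3^+3 * x5 * (2 * x4 + x1 * x5^+2)
             + x1 * x3^+2 * x4 * (2 * x4 + 3 * x1 * x5^+2))
  + x0 * x2 * x3 * (x1 * x3^+3 * x4
                    + x2 * (x1 * x4^+2 + 2 * x1 * x3 * x4 * x5
                            + x3^+2 * (x4 + x1 * x5^+2))).

Definition polQ : F :=
  x0^+2 * x2 * x3 + x1 * x2 * x3^+2 * x5
  + x0 * (x1 * x3^+3 + x2 * (x3^+2 + x1 * x4 + x1 * x3 * x5)).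

Definition polR : F :=
  x1 * x3^+3 * x4
  + x0 * x3 * (x1 * x3^+2 * x5 + x2 * (x4 + x3 * x5))
  + x2 * (x1 * x4^+2 + 2 * x1 * x3 * x4 * x5 + x3^+2 * (x4 + x1 * x5^+2)).

Definition polS : F :=
  x0^+3 * x3^+3 * x4 *
  (x2^+3 * x3^+3 * x4 + x1^+3 * x3^+6 * x4
   + x1^+2 * x2 * x3^+3 * x4 * (3 * x3^+2 + 2 * x1 * x4 + 3 * x1 * x3 * x5)
   + x1 * x2^+2 * (3 * x3^+4 * x4 + x1^+2 * x4^+3
                   + 3 * x1^+2 * x3 * x4^+2 * x5
                   + 3 * x1 * x3^+2 * x4 * (x4 + x1 * x5^+2)
                   + x1 * x3^+3 * x5 * (3 * x4 + x1 * x5^+2))).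

Definition sigma : 'I_6 -> F := tnth [tuple
  a_sol * x0;
  polP / (x0 * x1 * x2^+2 * x3^+3 * x4);
  x2 / x1^+3 + 3 * x3 / x1^+2 + x3^+3 / x2^+2
    + (x4 + x3 * x5)^+3 / (x3^+3 * x4) + (2 * x4 + 3 * x3 * x5) / x2
    + 3 * (x3^+3 + x2 * x4 + x2 * x3 * x5) / (x1 * x2 * x3);
  polQ * polR / (x0^+2 * polP);
  polR^+3 / polS;
  x0 * x5 * polR / (x4 * polQ)].

End Sigma.

Section Tau.
Variable y : 'I_6 -> F.
Local Notation y0 := (y c0).
Local Notation y1 := (y c1).
Local Notation y2 := (y c2).
Local Notation y3 := (y c3).
Local Notation y4 := (y c4).
Local Notation y5 := (y c5).

Definition polT : F :=
  y0^+3 * y4^+3 *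
    (y1^+6 * y4 + 3 * y1^+4 * y2 * y3 * y4 + 3 * y1^+2 * y2^+2 * y3^+2 * y4
     + 3 * y1 * y2^+2 * y3 * y4^+2 + y2^+2 * y4^+3
     + y1^+3 * y2 * (y2 * y3^+3 + 2 * y4^+2))
  + 3 * y0^+2 * y3 * y4^+2 *
    (y1^+2 * y2 * y3^+2 + y1^+3 * y4 + 2 * y1 * y2 * y3 * y4 + y2 * y4^+2) *
    (y1^+3 * y4 * y5 + 2 * y1 * y2 * y3 * y4 * y5 + y2 * y4^+2 * y5
     + y1^+2 * y2 * (y4 + y3^+2 * y5))
  + y3^+3 *
    (6 * y1 * y2^+2 * y3 * y4^+5 * y5^+3 + y2^+2 * y4^+6 * y5^+3
     + 3 * y1^+2 * y2^+2 * y4^+4 * y5^+2 * (y4 + 5 * y3^+2 * y5)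
     + 2 * y1^+3 * y2 * y4^+3 * y5^+2 *
       (6 * y2 * y3 * y4 + 10 * y2 * y3^+3 * y5 + y4^+2 * y5)
     + 3 * y1^+5 * y2 * y4 * y5 *
       (2 * y2 * y3 * (y4 + y3^+2 * y5)^+2
        + y4^+2 * y5 * (y4 + 2 * y3^+2 * y5))
     + y1^+6 *
       (y4^+4 * y5^+3 + y2^+2 * (y4 + y3^+2 * y5)^+3
        + y2 * y3 * y4^+2 * y5^+2 * (3 * y4 + 2 * y3^+2 * y5))
     + 3 * y1^+4 * y2 * y4^+2 * y5 *
       (2 * y3 * y4^+2 * y5^+2
        + y2 * (y4^+2 + 6 * y3^+2 * y4 * y5 + 5 * y3^+4 * y5^+2)))
  + 3 * y0 * y3^+2 * y4 *
    (5 * y1 * y2^+2 * y3 * y4^+4 * y5^+2 + y2^+2 * y4^+5 * y5^+2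
     + 2 * y1^+2 * y2^+2 * y4^+3 * y5 * (y4 + 5 * y3^+2 * y5)
     + 2 * y1^+3 * y2 * y4^+2 * y5 *
       (3 * y2 * y3 * y4 + 5 * y2 * y3^+3 * y5 + y4^+2 * y5)
     + y1^+6 * y4 * y5 * (y4^+2 * y5 + y2 * y3 * (y4 + y3^+2 * y5))
     + y1^+5 * y2 *
       (y2 * y3 * (y4 + y3^+2 * y5)^+2
        + 2 * y4^+2 * y5 * (y4 + 2 * y3^+2 * y5))
     + y1^+4 * y2 * y4 *
       (5 * y3 * y4^+2 * y5^+2
        + y2 * (y4^+2 + 6 * y3^+2 * y4 * y5 + 5 * y3^+4 * y5^+2))).

Definition polU : F :=
  y0^+2 * y4 + y1 * y3 * y4 * y5
  + y0 * (y3 * y4 * y5 + y1 * (y4 + y3^+2 * y5)).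

Definition polV : F :=
  3 * y1 * y2 * y3^+2 * y4^+2 * y5^+2 + y2 * y3 * y4^+3 * y5^+2
  + y1^+2 * y2 * y3 * y4 * y5 * (2 * y4 + 3 * y3^+2 * y5)
  + y0 * y4 * (y1^+3 * y4 * y5 + 2 * y1 * y2 * y3 * y4 * y5
               + y2 * y4^+2 * y5 + y1^+2 * y2 * (y4 + y3^+2 * y5))
  + y1^+3 * (y3 * y4^+2 * y5^+2 + y2 * (y4 + y3^+2 * y5)^+2).

Definition polW : F :=
  y0^+2 * y1 * y4^+2 *
  (y0 * (y1 * y2 * y3 * y4 + y2 * y4^+2 + y1^+3 * (y4 + y3^+2 * y5))
   + y3 * (y1^+3 * y4 * y5 + 2 * y1 * y2 * y3 * y4 * y5 + y2 * y4^+2 * y5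
           + y1^+2 * y2 * (y4 + y3^+2 * y5))).

Definition tau : 'I_6 -> F := tnth [tuple
  y3^-1 + y5 / y0 + y3 * y5 / y4 + (y0 / y3 + y5) / y1;
  y0^-1 * (1 + y3^+2 * y5 / y4 + y4 * (y0 / y3 + y5) / y1^+2
           + (y0 + 2 * y3 * y5) / y1
           + y1 * (y0 / y3 + y5 + y0 * y3 * y5 / y4) / y2);
  polT / (y0^+3 * y1^+6 * y2 * y3^+3 * y4^+3);
  polU * polV / polW;
  y1^+3 * y2^+2 * y4 * polU^+3 / (y0^+3 * polT);
  y1^+2 * y2 * y4 * y5 * polU / (y0 * polV)].

End Tau.
End Torus.

Notation ratfun R := {fraction {mpoly (complex R)[6]}}.

Section Rational.
Variable R : realType.
Local Notation C := (complex R).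
Local Notation K := (ratfun R).

Definition cst (c : C) : K := tofrac (c%:MP_[6]).

Definition Xvar (i : 'I_6) : K := tofrac ('X_i : {mpoly C[6]}).

Definition character_of (m : 'I_6 -> int) (phi : 'I_6 -> K) : K :=
  \prod_i phi i ^ m i.

Definition positive_comb (g : K) : Prop :=
  exists s : seq (R * ('I_6 -> int)),
    [/\ (0 < size s)%N, all (fun t => 0 < t.1) s &
        g = \sum_(t <- s) cst (real_complex R t.1) * character_of t.2 Xvar].

Definition positive (f : K) : Prop :=
  f != 0 /\ exists g h, [/\ positive_comb g, positive_comb h & f = g / h].

Definition positive_map (phi : 'I_6 -> K) : Prop :=
  forall m : 'I_6 -> int, positive (character_of m phi).

(* The rational function f is regular at the point v, with value w.  The
   point v has coordinates in an extension F of C: F = C gives ordinary points,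
   F = C(x) gives the substitution of rational functions into f. *)
Definition rat_value (F : fieldType) (iota : C -> F)
    (f : K) (v : 'I_6 -> F) (w : F) : Prop :=
  exists p q : {mpoly C[6]},
    [/\ f = tofrac p / tofrac q, mmap iota v q != 0 &
        w = mmap iota v p / mmap iota v q].

Definition comp_is (phi psi chi : 'I_6 -> K) : Prop :=
  forall i, rat_value cst (phi i) psi (chi i).

(* The graph of the map P(x) |-> Q(phi(x)) between the images of two
   parametrizations of subsets of W(varpi_1) by the torus. *)
Definition param_graph (P Q : ('I_6 -> C) -> 'cV[C]_8) (phi : 'I_6 -> K)
    (w w' : 'cV[C]_8) : Prop :=
  exists x y, [/\ torus x, torus y, w = P x, w' = Q y &
                  forall i, rat_value id (phi i) x (y i)].

Definition rational_map P Q (phi : 'I_6 -> K) : Prop :=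
  torus phi /\
  forall w w1 w2, param_graph P Q phi w w1 -> param_graph P Q phi w w2 ->
    w1 = w2.

Definition birational_pair P Q (phi psi : 'I_6 -> K) : Prop :=
  [/\ rational_map P Q phi, rational_map Q P psi,
      comp_is psi phi Xvar & comp_is phi psi Xvar].

End Rational.

Arguments Xvar : clear implicits.

(* Main.v *)
Require Import Defs.
From HB Require Import structures.
From mathcomp Require Import all_boot all_order all_algebra.
From mathcomp Require Import fraction complex reals mpoly.
From mathcomp Require Import boolp ring.

Set Implicit Arguments.
Unset Strict Implicit.
Unset Printing Implicit Defensive.

Import Order.TTheory GRing.Theory Num.Theory.
Local Open Scope ring_scope.

(** Both V1(x) and V2(y) are explicit vectors of Laurent polynomials, and
    the identities between them below hold over an arbitrary field in which
    2 is invertible: over the complex numbers, where they speak of points, and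
    over the function field, where they speak of the generic point and of its
    images under sigma and tau.

    Solving V2(y) = a V1(x).  Write w for V1(x), and w0 for its coefficient of
    v_0 minus half that of the empty vector.  Comparing coefficients expresses
    y0, y3, y4, y5 through a, y1, y2, and leaves for (y1, y2, a) a system of
    three linear equations with determinant - x2 x4 w1 w0
    ([V2_eq_linear], [V2_scaled_inj]).  This gives uniqueness wherever w1 and
    w0 do not vanish.  Existence ([sigma_solves]) is a verification, reduced
    in [V2_scaled_coords] to six short identities.

    The inverse.  The vector V1(x) satisfies one inhomogeneous equation, that
    its coefficient of v_1bar is the square of its coefficient of the empty
    vector.  A multiple of V2(y) lying in the image of V1 is therefore
    b V2(y) with b determined by V2(y), and x is read off from it
    successively ([V1_inj]).  That the formulas of tau do this,
    V1(tau(y)) = (tau_0(y) / y0) V2(y), is [tau_solves].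

    Composites.  Over the function field, tau after sigma is the identity
    because V1 is injective and its image meets a line through 0 in at most
    one nonzero point ([tau_sigma_id]); sigma after tau is the identity by
    uniqueness ([sigma_tau_id]).

    Positivity.  The formulas of sigma and tau are subtraction-free, so they
    are positive ([positive_subst_sigma], [positive_subst_tau]).  A positive
    function is nonzero, as is seen at the point (1, ..., 1); this disposes of
    every denominator and of the conditions on w1 and w0, both at the generic
    point and at its images, which are positive again.

    On points, sigma is well defined on the image of V1 because V1 is
    injective, and tau on the image of V2 because the factor b above depends
    only on V2(y) ([tau_graph_dilation]). *)

(** * The operators in coordinates *)

Section Coordinates.
Variable F : fieldType.

Definition col8 (a1 a2 a3 a0 aE b3 b2 b1 : F) : 'cV[F]_8 :=
  \col_i [:: a1; a2; a3; a0; aE; b3; b2; b1]`_i.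

Lemma col8_inj a1 a2 a3 a0 aE b3 b2 b1 a1' a2' a3' a0' aE' b3' b2' b1' :
  col8 a1 a2 a3 a0 aE b3 b2 b1 = col8 a1' a2' a3' a0' aE' b3' b2' b1' ->
  [/\ a1 = a1', a2 = a2', a3 = a3' & a0 = a0'] /\
  [/\ aE = aE', b3 = b3', b2 = b2' & b1 = b1'].
Proof.
move=> /colP e; split; split.
- by have := e bv1; rewrite !mxE.
- by have := e bv2; rewrite !mxE.
- by have := e bv3; rewrite !mxE.
- by have := e bv0; rewrite !mxE.
- by have := e bvE; rewrite !mxE.
- by have := e bv3b; rewrite !mxE.
- by have := e bv2b; rewrite !mxE.
- by have := e bv1b; rewrite !mxE.
Qed.

Lemma scale_col8 c a1 a2 a3 a0 aE b3 b2 b1 :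
  c *: col8 a1 a2 a3 a0 aE b3 b2 b1 =
  col8 (c * a1) (c * a2) (c * a3) (c * a0) (c * aE) (c * b3) (c * b2) (c * b1).
Proof.
by apply/colP=> -[[|[|[|[|[|[|[|[|//]]]]]]]] jp]; rewrite !mxE.
Qed.

Lemma add_col8 a1 a2 a3 a0 aE b3 b2 b1 a1' a2' a3' a0' aE' b3' b2' b1' :
  col8 a1 a2 a3 a0 aE b3 b2 b1 + col8 a1' a2' a3' a0' aE' b3' b2' b1' =
  col8 (a1 + a1') (a2 + a2') (a3 + a3') (a0 + a0') (aE + aE') (b3 + b3')
    (b2 + b2') (b1 + b1').
Proof.
by apply/colP=> -[[|[|[|[|[|[|[|[|//]]]]]]]] jp]; rewrite !mxE.
Qed.

(** The exponential series of f_i / c stops at its quadratic term because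
    the cube of f_i vanishes. *)
Lemma Y_act i c (v : 'cV[F]_8) :
  let u := coroot_act i c *m v in
  Y i c *m v = u + c^-1 *: (f F i *m u) + (c^-2 / 2) *: (f F i *m (f F i *m u)).
Proof.
move=> u.
rewrite /Y -mulmxA -/u /nexp !big_ord_recl big_ord0.
have f3 k : f F i ^+ k.+3 = 0 by rewrite (exprD _ 3 k) f_cube mul0r.
rewrite !exprZn !lift0 !f3 !scaler0 !addr0 /= expr0 expr1 invr1 !scale1r.
rewrite !mulmxDl mul1mx -scalemxAl addrA; congr (_ + _ + _).
by rewrite -!scalemxAl (expr2 (f F i)) -mulmxA scalerA exprVn mulrC.
Qed.

Lemma coroot_actE i c a1 a2 a3 a0 aE b3 b2 b1 :
  coroot_act i c *m col8 a1 a2 a3 a0 aE b3 b2 b1 =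
  match val i with
  | 0 => col8 (c ^- 2 * a1) (c^-1 * a2) (c^-1 * a3) a0 aE
           (c * b3) (c * b2) (c ^+ 2 * b1)
  | 1 => col8 (c * a1) (c^-1 * a2) (c ^+ 2 * a3) a0 aE
           (c ^- 2 * b3) (c * b2) (c^-1 * b1)
  | _ => col8 a1 (c * a2) (c^-1 * a3) a0 aE (c * b3) (c^-1 * b2) b1
  end.
Proof.
case: i => [[|[|[|//]]] ip];
apply/colP=> -[[|[|[|[|[|[|[|[|//]]]]]]]] jp];
  rewrite /coroot_act mul_diag_mx !mxE /pairing /wt /tnth /= !mxE /= ?mul1r //.
Qed.

Lemma delta_mulE (a b i : 'I_8) (v : 'cV[F]_8) :
  (delta_mx a b *m v) i 0 = (i == a)%:R * v b 0.
Proof.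
rewrite mxE (bigD1 b) //= big1 => [|k kb]; rewrite mxE ?eqxx ?andbT ?addr0 //.
by rewrite (negbTE kb) andbF mul0r.
Qed.

Lemma f0_col8 a1 a2 a3 a0 aE b3 b2 b1 :
  f F i0 *m col8 a1 a2 a3 a0 aE b3 b2 b1 =
  col8 (a0 + 3 / 2 * aE) b3 b2 (2^-1 * b1) b1 0 0 0.
Proof.
apply/colP=> i; rewrite /f /tnth /= ?mulmxDl -?scalemxAl !(delta_mulE, mxE).
by case: i => [[|[|[|[|[|[|[|[|//]]]]]]]] ip] /=; ring.
Qed.

Lemma f1_col8 a1 a2 a3 a0 aE b3 b2 b1 :
  f F i1 *m col8 a1 a2 a3 a0 aE b3 b2 b1 =
  col8 0 a1 0 a3 0 (2 * a0) 0 b2.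
Proof.
apply/colP=> i; rewrite /f /tnth /= ?mulmxDl -?scalemxAl !(delta_mulE, mxE).
by case: i => [[|[|[|[|[|[|[|[|//]]]]]]]] ip] /=; ring.
Qed.

Lemma f2_col8 a1 a2 a3 a0 aE b3 b2 b1 :
  f F i2 *m col8 a1 a2 a3 a0 aE b3 b2 b1 =
  col8 0 0 a2 0 0 0 b3 0.
Proof.
apply/colP=> i; rewrite /f /tnth /= ?mulmxDl -?scalemxAl !(delta_mulE, mxE).
by case: i => [[|[|[|[|[|[|[|[|//]]]]]]]] ip] /=; ring.
Qed.

Lemma Y0_col8 c a1 a2 a3 a0 aE b3 b2 b1 : 2 != 0 :> F -> c != 0 ->
  Y i0 c *m col8 a1 a2 a3 a0 aE b3 b2 b1 =
  col8 (a1 / c ^+ 2 + (a0 + 3 / 2 * aE) / c + b1) (a2 / c + b3) (a3 / c + b2)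
    (a0 + c * b1 / 2) (aE + c * b1) (c * b3) (c * b2) (c ^+ 2 * b1).
Proof.
move=> n2 cn; rewrite Y_act coroot_actE /= !f0_col8 !scale_col8 !add_col8.
by congr col8; field; rewrite ?n2 ?cn.
Qed.

Lemma Y1_col8 c a1 a2 a3 a0 aE b3 b2 b1 : 2 != 0 :> F -> c != 0 ->
  Y i1 c *m col8 a1 a2 a3 a0 aE b3 b2 b1 =
  col8 (c * a1) (a2 / c + a1) (c ^+ 2 * a3) (a0 + c * a3) aE
    (b3 / c ^+ 2 + 2 * a0 / c + a3) (c * b2) (b1 / c + b2).
Proof.
move=> n2 cn; rewrite Y_act coroot_actE /= !f1_col8 !scale_col8 !add_col8.
by congr col8; field; rewrite ?n2 ?cn.
Qed.

Lemma Y2_col8 c a1 a2 a3 a0 aE b3 b2 b1 : c != 0 ->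
  Y i2 c *m col8 a1 a2 a3 a0 aE b3 b2 b1 =
  col8 a1 (c * a2) (a3 / c + a2) a0 aE (c * b3) (b2 / c + b3) b1.
Proof.
move=> cn; rewrite Y_act coroot_actE /= !f2_col8 !scale_col8 !add_col8.
by congr col8; rewrite !mulr0 !addr0 //; field.
Qed.

End Coordinates.
Arguments col8 {F}.

Local Ltac nonzero := do ?[apply/andP; split]; by [].

(** * The two parametrizations in coordinates *)

Section Parametrizations.
Variable F : fieldType.
Hypothesis two_neq0 : 2 != 0 :> F.

Lemma V1E (x : 'I_6 -> F) : torus x ->
  let x0 := x c0 in let x1 := x c1 in let x2 := x c2 in
  let x3 := x c3 in let x4 := x c4 in let x5 := x c5 in
  let A := x3 ^+ 2 / x2 + x4 / x3 + x5 in
  let B := x2 / x1 ^+ 2 + 2 * x3 / x1 + A in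
  V1 x = col8
    (x1 * x3 * x5 / x0 ^+ 2 + (x3 + x1 * A) / x0 + 1)
    (x2 / (x0 * x1) * (x4 / x3 + x5) + x3 * x5 / x0 + B)
    (x1 ^+ 2 / x0 * A + x1)
    (x3 + x1 * A + x0 / 2)
    x0 (x0 * B) (x0 * x1) (x0 ^+ 2).
Proof.
move=> xn; have [h0 h1 h2] := And3 (xn c0) (xn c1) (xn c2).
have [h3 h4 h5] := And3 (xn c3) (xn c4) (xn c5).
rewrite /V1; move: (x c0) (x c1) (x c2) (x c3) (x c4) (x c5) h0 h1 h2 h3 h4 h5.
move=> x0 x1 x2 x3 x4 x5 h0 h1 h2 h3 h4 h5 /=.
have -> : bvec F bv1 = col8 1 0 0 0 0 0 0 0.
  by apply/colP=> -[[|[|[|[|[|[|[|[|//]]]]]]]] jp]; rewrite !mxE.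
rewrite Y1_col8 // Y2_col8 // Y1_col8 // Y2_col8 // Y1_col8 // Y0_col8 //.
by congr col8; field; nonzero.
Qed.

Lemma V2E (y : 'I_6 -> F) : torus y ->
  let y0 := y c0 in let y1 := y c1 in let y2 := y c2 in
  let y3 := y c3 in let y4 := y c4 in let y5 := y c5 in
  let D := 1 + y3 ^+ 2 / y4 * y5 in
  let C := y4 / y1 ^+ 2 * (y0 / y3 + y5) + (y0 + 2 * y3 * y5) / y1 + D in
  V2 y = col8
    (y1 * y3)
    (y2 * (y4 / y1 + y3))
    (y4 / y1 + y3 + y1 ^+ 2 / y2 * D)
    (y3 * y5 + y1 * D + y0 / 2)
    y0 (y2 * C)
    (C + y1 / y2 * (y5 + y0 / y3 * D))
    (y5 + y0 / y1 * (y5 + y0 / y3) + y0 / y3 * D).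
Proof.
move=> yn; have [h0 h1 h2] := And3 (yn c0) (yn c1) (yn c2).
have [h3 h4 h5] := And3 (yn c3) (yn c4) (yn c5).
rewrite /V2; move: (y c0) (y c1) (y c2) (y c3) (y c4) (y c5) h0 h1 h2 h3 h4 h5.
move=> y0 y1 y2 y3 y4 y5 h0 h1 h2 h3 h4 h5 /=.
have -> : bvec F bv2b = col8 0 0 0 0 0 0 1 0.
  by apply/colP=> -[[|[|[|[|[|[|[|[|//]]]]]]]] jp]; rewrite !mxE.
rewrite Y1_col8 // Y0_col8 // Y1_col8 // Y2_col8 // Y1_col8 // Y2_col8 //.
by congr col8; field; nonzero.
Qed.

End Parametrizations.

(** * Existence of the solution *)

Section Solutions.
Variable F : fieldType.
Hypothesis two_neq0 : 2 != 0 :> F.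

(** The reduction that makes existence tractable.  With s = x1 x3 x5,
    u = x2 x4 and w = V1(x), four of the unknowns are tied to a, y1, y2 by
    y0 = a x0, y1 y3 = a w1, y2 y4 = a^3 u, y5 w1 = a s.  Substituting them
    turns the eight components of the equation into combinations of the six
    identities assumed here, which involve only a, y1, y2 and x.  The first
    of these, a^2 u = w2 y1 - w1 y2, accounts for most cancellations; w0 is
    the coefficient of v_0 diminished by half that of the empty vector. *)
Lemma V2_scaled_coords (y : 'I_6 -> F) (a x0 x1 s u w1 w2 w3 w0 w3b : F) :
  torus y -> a != 0 -> w1 != 0 -> u != 0 ->
  y c0 = a * x0 -> y c3 = a * w1 / y c1 -> y c4 = a ^+ 3 * u / y c2 ->
  y c5 = a * s / w1 ->
  a ^+ 2 * u = w2 * y c1 - w1 * y c2 ->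
  y c1 + s * w2 / u = a * w0 ->
  a * w2 + y c1 ^+ 2 + w1 * s * y c2 / u = a * w3 * y c2 ->
  s * w2 ^+ 2 / (u * w1) + y c2 + a * x0 * w2 / w1 = a * w3b ->
  a * w3b + (a * s * y c1 + x0 * y c1 ^+ 2) / w1 + x0 * s * y c2 / u =
    a * x0 * x1 * y c2 ->
  s + x0 * w0 + x0 ^+ 2 = x0 ^+ 2 * w1 ->
  V2 y = a *: col8 w1 w2 w3 (w0 + x0 / 2) x0 w3b (x0 * x1) (x0 ^+ 2).
Proof.
move=> yn an w1n un e0 e3 e4 e5 /eqP; rewrite -subr_eq0 => /eqP eA.
move=> /eqP; rewrite -subr_eq0 => /eqP eB.
move=> /eqP; rewrite -subr_eq0 => /eqP eC.
move=> /eqP; rewrite -subr_eq0 => /eqP eD.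
move=> /eqP; rewrite -subr_eq0 => /eqP eF.
move=> /eqP; rewrite -subr_eq0 => /eqP eG.
rewrite (V2E two_neq0 yn) /= scale_col8.
have [h0 h1 h2] := And3 (yn c0) (yn c1) (yn c2).
have x0n : x0 != 0 by apply: contraNneq h0; rewrite e0 => ->; rewrite mulr0.
rewrite e3 e4 e5 e0.
move: (y c1) (y c2) h1 h2 eA eB eC eD eF.
move=> y1 y2 h1 h2 eA eB eC eD eF {y yn h0 e0 e3 e4 e5}.
(* A component holds once its two sides differ by a combination of the six
   identities; below, each component comes with its multipliers. *)
have combo (A B C D E G l r : F) :
    l - r =
      A * (a ^+ 2 * u - (w2 * y1 - w1 * y2)) +
      B * (y1 + s * w2 / u - a * w0) +
      C * (a * w2 + y1 ^+ 2 + w1 * s * y2 / u - a * w3 * y2) +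
      D * (s * w2 ^+ 2 / (u * w1) + y2 + a * x0 * w2 / w1 - a * w3b) +
      E * (a * w3b + (a * s * y1 + x0 * y1 ^+ 2) / w1 + x0 * s * y2 / u -
           a * x0 * x1 * y2) +
      G * (s + x0 * w0 + x0 ^+ 2 - x0 ^+ 2 * w1) -> l = r.
  by rewrite eA eB eC eD eF eG !mulr0 !addr0 => /eqP; rewrite subr_eq0 => /eqP.
pose m := a * x0 / (w1 * y1) +
  s / (u * w1 * y1 ^+ 2) * (a ^+ 2 * u + w1 * y2 + w2 * y1).
congr col8.
- by field; nonzero.
- by apply: (combo (a / y1) 0 0 0 0 0); field; nonzero.
- by apply: (combo (a / (y1 * y2)) 0 y2^-1 0 0 0); field; nonzero.
- by apply: (combo (s / (u * y1)) 1 0 0 0 0); field; nonzero.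
- by apply: (combo m 0 0 1 0 0); rewrite /m; field; nonzero.
- by apply: (combo (m / y2) 0 0 y2^-1 y2^-1 0); rewrite /m; field; nonzero.
- apply: (combo (x0 * s / (u * w1 * y1)) (x0 / w1) 0 0 0 (a / w1)).
  by field; nonzero.
Qed.

Lemma sigma_solves (x : 'I_6 -> F) : torus x -> torus (sigma x) ->
  V2 (sigma x) = a_sol x *: V1 x.
Proof.
move=> xn yn.
(* A vanishing factor would annul a coordinate of sigma x, also when it is a
   denominator, as 0^-1 = 0. *)
have [sn0 sn1 sn4 sn5] := And4 (yn c0) (yn c1) (yn c4) (yn c5).
rewrite /sigma /tnth /= in sn0 sn1 sn4 sn5.
have an : a_sol x != 0 by apply: contraNneq sn0 => ->; rewrite mul0r.
have Pn : polP x != 0 by apply: contraNneq sn1 => ->; rewrite mul0r.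
have Qn : polQ x != 0.
  by apply: contraNneq sn5 => ->; rewrite mulr0 invr0 mulr0.
have Rn : polR x != 0 by apply: contraNneq sn5 => ->; rewrite mulr0 mul0r.
have Sn : polS x != 0 by apply: contraNneq sn4 => ->; rewrite invr0 mulr0.
have [h0 h1 h2] := And3 (xn c0) (xn c1) (xn c2).
have [h3 h4 h5] := And3 (xn c3) (xn c4) (xn c5).
(* The numerator of a is R, and the coefficient of v_1 in V1(x) is Q up to a
   monomial; this explains the factors Q and R of y3, y4, y5. *)
have aE : a_sol x = polR x / (x c0 * x c1 * x c2 * x c3 ^+ 2 * x c4).
  by rewrite /a_sol /polR; field; nonzero.
have y2E : sigma x c2 = polS x /
    (x c0 ^+ 3 * x c1 ^+ 3 * x c2 ^+ 2 * x c3 ^+ 6 * x c4 ^+ 2).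
  by rewrite /sigma /tnth /= /polS; field; nonzero.
pose Lw1 := x c1 * x c3 * x c5 / x c0 ^+ 2 +
  (x c3 + x c1 * (x c3 ^+ 2 / x c2 + x c4 / x c3 + x c5)) / x c0 + 1.
have w1E : Lw1 = polQ x / (x c0 ^+ 2 * x c2 * x c3).
  by rewrite /Lw1 /polQ; field; nonzero.
rewrite (V1E two_neq0 xn) /=; apply: (@V2_scaled_coords (sigma x) (a_sol x)
  (x c0) (x c1) (x c1 * x c3 * x c5) (x c2 * x c4)) => //.
- by rewrite -/Lw1 w1E mulf_neq0 // invr_neq0 // !mulf_neq0 // expf_neq0.
- by rewrite mulf_neq0.
- by rewrite -/Lw1 w1E aE /sigma /tnth /=; field; nonzero.
- by rewrite y2E aE /sigma /tnth /=; field; nonzero.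
- by rewrite -/Lw1 w1E aE /sigma /tnth /=; field; nonzero.
- by rewrite /sigma /tnth /= /a_sol /polP; field; nonzero.
- by rewrite /sigma /tnth /= /a_sol /polP; field; nonzero.
- by rewrite /sigma /tnth /= /a_sol /polP; field; nonzero.
- by rewrite -/Lw1 w1E /sigma /tnth /= /a_sol /polQ; field; nonzero.
- by rewrite -/Lw1 w1E /sigma /tnth /= /a_sol /polP /polQ; field; nonzero.
- by field; nonzero.
Qed.

End Solutions.

(** * Uniqueness of the solution, and injectivity of V1 *)

Section Uniqueness.
Variable F : fieldType.
Hypothesis two_neq0 : 2 != 0 :> F.

(** The coordinates can be read off one at a time, in the order x0, x1,
    A = x3^2/x2 + x4/x3 + x5, x3, x2, x5, x4: in this order each occurs
    affinely, with a nonzero monomial coefficient, in one component of V1(x),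
    or in A for the last. *)
Lemma V1_inj (x x' : 'I_6 -> F) :
  torus x -> torus x' -> V1 x = V1 x' -> x =1 x'.
Proof.
move=> xn xn'; rewrite (V1E two_neq0 xn) (V1E two_neq0 xn') /=.
have [h0 h1 h2] := And3 (xn c0) (xn c1) (xn c2).
have [h3 h4 h5] := And3 (xn c3) (xn c4) (xn c5).
have [k0 k1 k2] := And3 (xn' c0) (xn' c1) (xn' c2).
have [k3 k4 k5] := And3 (xn' c3) (xn' c4) (xn' c5).
move=> /col8_inj[[e1 e2 e3 e0] [eE eb3 eb2 _]].
have e00 := eE; have e11 : x c1 = x' c1 by move: eb2; rewrite eE => /(mulfI k0).
rewrite e00 e11 in e1 e2 e3 e0 eb3 *.
pose A (z : 'I_6 -> F) := z c3 ^+ 2 / z c2 + z c4 / z c3 + z c5.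
have eA : A x = A x'.
  by move/addIr: e3; apply: mulfI; rewrite mulf_neq0 ?invr_neq0 ?expf_neq0.
rewrite -/(A x) -/(A x') eA in e1 e2 e3 e0 eb3.
have e33 : x c3 = x' c3 by move: e0 => /addIr/addIr.
rewrite e33 in e1 e2 eb3.
have e22 : x c2 = x' c2.
  move: eb3 => /(mulfI k0)/addIr/addIr; apply: mulIf.
  by rewrite invr_neq0 ?expf_neq0.
have e55 : x c5 = x' c5.
  move: e1 => /addIr/addIr/mulIf e; apply: (mulfI (mulf_neq0 k1 k3)).
  by apply: e; rewrite invr_neq0 ?expf_neq0.
have e44 : x c4 = x' c4.
  move: eA; rewrite /A e33 e22 e55 => /addIr/addrI; apply: mulIf.
  by rewrite invr_neq0.
by move=> -[[|[|[|[|[|[|//]]]]]] ip]; rewrite (bool_irrelevance ip isT).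
Qed.

(** The first relation gives y5 from v = V2(y), the last gives y4 from y1, y2
    and v, and the three in between are affine in (y1, y2) once v and y5 are
    given. *)
Lemma V2_coord_relations (y : 'I_6 -> F) : torus y ->
  exists v2 v3 v0 v3b v2b v1b,
  let v1 := y c1 * y c3 in
  [/\ V2 y = col8 v1 v2 v3 (v0 + y c0 / 2) (y c0) v3b v2b v1b,
     v1 * v1b = v1 * y c5 + y c0 * v0 + y c0 ^+ 2 &
     [/\ v3 * y c2 = v2 + y c1 * v0 - v1 * y c5,
         v1 * v3b = v1 * y c2 + y c0 * v2 + v2 * (v0 - y c1),
         v1 * (y c2 * v2b) =
           v1 * (v3b + y c1 * y c5) + y c0 * (y c1 * v0 - v1 * y c5) &
         y c2 * y c4 = v2 * y c1 - v1 * y c2]].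
Proof.
move=> yn; rewrite (V2E two_neq0 yn) /=.
do 6!eexists; split; first reflexivity.
all: have [h0 h1 h2] := And3 (yn c0) (yn c1) (yn c2).
all: have [h3 h4 h5] := And3 (yn c3) (yn c4) (yn c5).
  by field; nonzero.
by split; field; nonzero.
Qed.

Lemma cramer3 (a11 a12 a13 a21 a22 a23 a31 a32 a33 d1 d2 d3 : F) :
  let D := a11 * (a22 * a33 - a23 * a32) - a12 * (a21 * a33 - a23 * a31)
           + a13 * (a21 * a32 - a22 * a31) in
  D != 0 ->
  a11 * d1 + a12 * d2 + a13 * d3 = 0 ->
  a21 * d1 + a22 * d2 + a23 * d3 = 0 ->
  a31 * d1 + a32 * d2 + a33 * d3 = 0 -> [/\ d1 = 0, d2 = 0 & d3 = 0].
Proof.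
move=> D Dn e1 e2 e3; split; apply: (mulfI Dn); rewrite mulr0.
- transitivity ((a22 * a33 - a23 * a32) * (a11 * d1 + a12 * d2 + a13 * d3)
   - (a12 * a33 - a13 * a32) * (a21 * d1 + a22 * d2 + a23 * d3)
   + (a12 * a23 - a13 * a22) * (a31 * d1 + a32 * d2 + a33 * d3)).
    by rewrite /D; ring.
  by rewrite e1 e2 e3 !mulr0 subr0 addr0.
- transitivity (- (a21 * a33 - a23 * a31) * (a11 * d1 + a12 * d2 + a13 * d3)
   + (a11 * a33 - a13 * a31) * (a21 * d1 + a22 * d2 + a23 * d3)
   - (a11 * a23 - a13 * a21) * (a31 * d1 + a32 * d2 + a33 * d3)).
    by rewrite /D; ring.
  by rewrite e1 e2 e3 !mulr0 subr0 addr0.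
- transitivity ((a21 * a32 - a22 * a31) * (a11 * d1 + a12 * d2 + a13 * d3)
   - (a11 * a32 - a12 * a31) * (a21 * d1 + a22 * d2 + a23 * d3)
   + (a11 * a22 - a12 * a21) * (a31 * d1 + a32 * d2 + a33 * d3)).
    by rewrite /D; ring.
  by rewrite e1 e2 e3 !mulr0 subr0 addr0.
Qed.

(** Dividing the relations above by a power of a yields a linear system of
    size three for (y1, y2, a), although the equation V2(y) = a w is far from
    linear; the hypothesis on s is the relation that V1 imposes on w. *)
Lemma V2_eq_linear (y : 'I_6 -> F) (a x0 x1 s w1 w2 w3 w0 w3b : F) :
  torus y -> w1 != 0 -> s + x0 * w0 + x0 ^+ 2 = x0 ^+ 2 * w1 ->
  V2 y = a *: col8 w1 w2 w3 (w0 + x0 / 2) x0 w3b (x0 * x1) (x0 ^+ 2) ->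
  [/\ w0 * y c1 - w3 * y c2 - s * a = - w2,
      w2 * y c1 - w1 * y c2 + (w1 * w3b - x0 * w2 - w2 * w0) * a = 0,
      x0 ^+ 2 * (w1 - 1) * y c1 - x0 * x1 * w1 * y c2 - x0 * s * a =
        - (w1 * w3b) &
  [/\ a != 0, y c0 = a * x0, y c3 = a * w1 / y c1,
      y c4 = a * (w2 * y c1 - w1 * y c2) / y c2 & y c5 = a * s / w1]].
Proof.
move=> yn w1n sE.
have [v2 [v3 [v0 [v3b [v2b [v1b]]]]]] := V2_coord_relations yn.
rewrite scale_col8 /= => -[-> q1 [q2 q3 q4 q5]].
move=> /col8_inj[[e1 e2 e3 e0] [eE eb3 eb2 eb1]].
have [h0 h1 h2] := And3 (yn c0) (yn c1) (yn c2).
have an : a != 0 by apply: contraNneq h0; rewrite eE => ->; rewrite mul0r.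
have e00 : v0 = a * w0 by move: e0; rewrite eE mulrDr mulrA => /addIr.
rewrite e1 e2 e3 eE eb3 eb2 eb1 e00 in q1 q2 q3 q4 q5.
have e5 : y c5 = a * s / w1.
  have sE' : s = x0 ^+ 2 * w1 - x0 ^+ 2 - x0 * w0 by rewrite -sE; ring.
  apply: (mulfI (mulf_neq0 an w1n)).
  transitivity (a * w1 * y c5 + a * x0 * (a * w0) + (a * x0) ^+ 2
    - a * x0 * (a * w0) - (a * x0) ^+ 2).
    by ring.
  by rewrite -q1 sE'; field.
rewrite e5 in q2 q4.
have sE' : x0 * w0 = x0 ^+ 2 * w1 - x0 ^+ 2 - s by rewrite -sE; ring.
split.
- apply: (mulfI an).
  transitivity (- (a * w3 * y c2) + y c1 * (a * w0) - a * w1 * (a * s / w1)).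
    by field.
  by rewrite q2; field.
- apply: (mulfI an).
  transitivity (a * w1 * (a * w3b) -
    (a * w1 * y c2 + a * x0 * (a * w2) + a * w2 * (a * w0 - y c1))).
    by ring.
  by rewrite q3; ring.
- apply: (mulfI (mulf_neq0 an an)).
  transitivity (a ^+ 2 * (s + x0 * w0) * y c1
    - a * w1 * (y c2 * (a * (x0 * x1))) - a ^+ 3 * x0 * s).
    by rewrite sE'; ring.
  by rewrite q4; field.
- split=> //; first by rewrite -e1; field.
  by apply: (mulfI h2); rewrite q5; field.
Qed.

(** The determinant of the linear system is - x2 x4 w1 w0, where w1 is the
    coefficient of v_1 in V1(x) and w0 that of v_0 diminished by x0 / 2. *)
Lemma V2_scaled_inj (x y y' : 'I_6 -> F) (a a' : F) :
  torus x -> torus y -> torus y' ->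
  V1 x bv1 0 != 0 -> V1 x bv0 0 != x c0 / 2 ->
  V2 y = a *: V1 x -> V2 y' = a' *: V1 x -> a = a' /\ y =1 y'.
Proof.
move=> xn yn yn'; rewrite (V1E two_neq0 xn) /= !mxE /= => w1n.
rewrite -subr_eq0 addrK => w0n.
have [h0 h1 h2] := And3 (xn c0) (xn c1) (xn c2).
have [h3 h4 h5] := And3 (xn c3) (xn c4) (xn c5).
pose A := x c3 ^+ 2 / x c2 + x c4 / x c3 + x c5.
pose w0 := x c3 + x c1 * A.
pose w1 := x c1 * x c3 * x c5 / x c0 ^+ 2 + w0 / x c0 + 1.
pose B := x c2 / x c1 ^+ 2 + 2 * x c3 / x c1 + A.
pose w2 := x c2 / (x c0 * x c1) * (x c4 / x c3 + x c5) + x c3 * x c5 / x c0 + B.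
pose w3 := x c1 ^+ 2 / x c0 * A + x c1.
pose w3b := x c0 * B.
pose s := x c1 * x c3 * x c5.
have sE : s + x c0 * w0 + x c0 ^+ 2 = x c0 ^+ 2 * w1 by rewrite /s /w1; field.
have linear z b := V2_eq_linear (y := z) (a := b) (x0 := x c0) (x1 := x c1)
  (s := s) (w1 := w1) (w2 := w2) (w3 := w3) (w0 := w0) (w3b := w3b).
move=> /(linear _ _ yn w1n sE)[l1 l2 l3 [_ e0 e3 e4 e5]].
move=> /(linear _ _ yn' w1n sE)[l1' l2' l3' [_ e0' e3' e4' e5']].
have eqsub (l l' r : F) : l = r -> l' = r -> l - l' = 0.
  by move=> -> ->; rewrite subrr.
have [] := @cramer3 w0 (- w3) (- s) w2 (- w1) (w1 * w3b - x c0 * w2 - w2 * w0)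
  (x c0 ^+ 2 * (w1 - 1)) (- (x c0 * x c1 * w1)) (- (x c0 * s))
  (y c1 - y' c1) (y c2 - y' c2) (a - a').
- set D := (X in X != 0); have -> : D = - (x c2 * x c4 * w1 * w0).
    rewrite /D /w3b /w3 /w2 /B /w1 /s /w0 /A; field; nonzero.
  by rewrite oppr_eq0 !mulf_neq0.
- by rewrite -[RHS](eqsub _ _ _ l1 l1'); ring.
- by rewrite -[RHS](eqsub _ _ _ l2 l2'); ring.
- by rewrite -[RHS](eqsub _ _ _ l3 l3'); ring.
move=> /eqP; rewrite subr_eq0 => /eqP d1 /eqP; rewrite subr_eq0 => /eqP d2.
move=> /eqP; rewrite subr_eq0 => /eqP d3; split=> //.
move=> -[[|[|[|[|[|[|//]]]]]] ip]; rewrite (bool_irrelevance ip isT).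
- by rewrite e0 e0' d3.
- by [].
- by [].
- by rewrite e3 e3' d3 d1.
- by rewrite e4 e4' d3 d1 d2.
- by rewrite e5 e5' d3.
Qed.

End Uniqueness.

(** * The inverse map *)

Section Inverse.
Variable F : fieldType.
Hypothesis two_neq0 : 2 != 0 :> F.

(** In terms of v = V2(y) and b = x0 / y0, the point x = tau(y) satisfies
    x0 = b y0, x1 = v_2bar / y0, x1 x3 x5 = b^2 y1 y3 y5 and
    x2 x4 = b^3 y2 y4, while x1 x3 and x2 are Laurent polynomials in y.  All
    components of V1(x) are functions of these quantities, so the large
    polynomials T, V, W are expanded only in checking these facts; b is U
    up to a monomial, and x1 is W up to a monomial. *)
Lemma tau_solves (y : 'I_6 -> F) : torus y -> torus (tau y) ->
  V1 (tau y) = (tau y c0 / y c0) *: V2 y.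
Proof.
move=> yn xn.
have [tn2 tn3] := conj (xn c2) (xn c3).
rewrite /tau /tnth /= in tn2 tn3.
have Vn : polV y != 0 by apply: contraNneq tn3 => ->; rewrite mulr0 mul0r.
have Un : polU y != 0 by apply: contraNneq tn3 => ->; rewrite !mul0r.
have Wn : polW y != 0 by apply: contraNneq tn3 => ->; rewrite invr0 mulr0.
have Tn : polT y != 0 by apply: contraNneq tn2 => ->; rewrite mul0r.
have [h0 h1 h2] := And3 (yn c0) (yn c1) (yn c2).
have [h3 h4 h5] := And3 (yn c3) (yn c4) (yn c5).
have [g0 g1 g2] := And3 (xn c0) (xn c1) (xn c2).
have [g3 g4 g5] := And3 (xn c3) (xn c4) (xn c5).
set b := tau y c0 / y c0.
rewrite (V1E two_neq0 xn) (V2E two_neq0 yn) /= scale_col8.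
set D := 1 + y c3 ^+ 2 / y c4 * y c5.
set C := _ + _ + D.
set v2 := y c2 * (_ + _); set v3 := _ + _ + _ / _ * D.
set v2b := C + _; set v1b := y c5 + _ + _; set v3b := y c2 * C.
pose v0 := y c3 * y c5 + y c1 * D.
have x0E : tau y c0 = b * y c0 by rewrite /b; field.
have v1bE : v1b = b * y c0 ^+ 2.
  by rewrite /b /v1b /D /tau /tnth /=; field; nonzero.
have bE : b = polU y / (y c0 ^+ 2 * y c1 * y c3 * y c4).
  by rewrite /b /polU /tau /tnth /=; field; nonzero.
have v2bE : v2b = y c0 * tau y c1.
  by rewrite /v2b /C /D /tau /tnth /=; field; nonzero.
have WE : polW y =
    y c0 ^+ 3 * y c1 ^+ 3 * y c2 * y c3 * y c4 ^+ 3 * tau y c1.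
  by rewrite /polW /tau /tnth /=; field; nonzero.
have x13V : tau y c1 * tau y c3 =
    polU y * polV y / (y c0 ^+ 3 * y c1 ^+ 3 * y c2 * y c3 * y c4 ^+ 3).
  by rewrite {2}/tau /tnth /= WE; field; nonzero.
have x13E : tau y c1 * tau y c3 = b * (v2b * (v0 + y c0) - v3 * v1b) / y c0.
  by rewrite x13V bE /v2b /v1b /v3 /v0 /C /D /polV; field; nonzero.
have x2E : tau y c2 = tau y c1 ^+ 2 * v3b / y c0 - 2 * (tau y c1 * tau y c3)
    - (b * v3 - tau y c1) * tau y c0.
  rewrite x13V x0E bE /v3b /v3 /C /D /polV /polU /tau /tnth /= /polT.
  by field; nonzero.
have sE : tau y c1 * tau y c3 * tau y c5 = b ^+ 2 * (y c1 * y c3) * y c5.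
  by rewrite x13V bE /tau /tnth /=; field; nonzero.
have uE : tau y c2 * tau y c4 = b ^+ 3 * (y c2 * y c4).
  by rewrite bE /tau /tnth /=; field; nonzero.
pose A := tau y c3 ^+ 2 / tau y c2 + tau y c4 / tau y c3 + tau y c5.
have AE : tau y c1 ^+ 2 * A = (b * v3 - tau y c1) * tau y c0.
  apply: (mulfI (mulf_neq0 (mulf_neq0 g1 g2) g3)).
  (* In this form x3, x4 and x5 occur only through x1 x3, x2 x4 and
     x1 x3 x5. *)
  transitivity ((tau y c1 * tau y c3) ^+ 3
    + tau y c1 ^+ 3 * (tau y c2 * tau y c4)
    + tau y c1 ^+ 2 * tau y c2 * (tau y c1 * tau y c3 * tau y c5)).
    by rewrite /A; field; nonzero.
  transitivity (tau y c2 * (tau y c1 * tau y c3) *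
    ((b * v3 - tau y c1) * tau y c0)); last by ring.
  rewrite sE uE x2E x13E x0E bE /polU /tau /tnth /=.
  rewrite /v3 /v3b /v2b /v1b /v0 /C /D.
  by field; nonzero.
rewrite -/A.
have w0E : tau y c3 + tau y c1 * A = b * v0.
  apply: (mulfI g1).
  transitivity (tau y c1 * tau y c3 + tau y c1 ^+ 2 * A); first by ring.
  have x1E : tau y c1 = v2b / y c0 by rewrite v2bE; field.
  by rewrite AE x13E v1bE x0E x1E; field.
have BE :
    tau y c2 / tau y c1 ^+ 2 + 2 * tau y c3 / tau y c1 + A = v3b / y c0.
  apply: (mulfI (expf_neq0 2 g1)); rewrite x2E -AE.
  by field; nonzero.
have bn : b != 0 by rewrite /b mulf_neq0 ?invr_neq0.
rewrite w0E BE; congr col8.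
- rewrite sE x0E; apply: (mulIf (expf_neq0 2 h0)).
  transitivity (y c1 * y c3 * v1b); last by rewrite v1bE; ring.
  by rewrite /v1b /v0 /D; field; nonzero.
- apply: (mulfI (mulf_neq0 g0 (expf_neq0 3 g1))).
  transitivity (tau y c2 * (tau y c1 ^+ 2 * A) - (tau y c1 * tau y c3) ^+ 2
    + tau y c1 ^+ 2 * (tau y c1 * tau y c3 * tau y c5)
    + tau y c0 * tau y c1 ^+ 3 * (v3b / y c0)).
    by rewrite /A; field; nonzero.
  rewrite AE sE x2E x13E x0E bE /polU /tau /tnth /=.
  rewrite /v3 /v3b /v2b /v1b /v2 /v0 /C /D.
  by field; nonzero.
- transitivity (tau y c1 ^+ 2 * A / tau y c0 + tau y c1); first by ring.
  by rewrite AE; field.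
- by rewrite x0E -/v0; field.
- by rewrite x0E.
- by rewrite x0E; field.
- by rewrite x0E v2bE; ring.
- by rewrite x0E v1bE; ring.
Qed.

End Inverse.

(** * Values of rational functions *)

Section RatValue.
Variables (R : realType) (F : fieldType) (iota : {rmorphism complex R -> F}).
Variable v : 'I_6 -> F.
Implicit Types (f g : ratfun R) (w z : F).
Local Notation rv f w := (rat_value iota f v w).

Lemma rat_value_den_neq0 (q : {mpoly (complex R)[6]}) : mmap iota v q != 0 ->
  tofrac q != 0 :> ratfun R.
Proof. by rewrite tofrac_eq0; apply: contraNneq => ->; rewrite mmap0. Qed.

Lemma rat_value_inj f w z : rv f w -> rv f z -> w = z.
Proof.
move=> [p [q [-> qn ->]]] [p' [q' [/eqP e q'n ->]]].
move: e; rewrite eqr_div ?rat_value_den_neq0 // -!rmorphM tofrac_eq => /eqP e.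
by apply/eqP; rewrite eqr_div // -!rmorphM e.
Qed.

Lemma rat_value_poly (p : {mpoly (complex R)[6]}) :
  rv (tofrac p) (mmap iota v p).
Proof. by exists p, 1; rewrite !rmorph1 !divr1 oner_neq0. Qed.

Lemma rat_value_nat n : rv n%:R n%:R.
Proof. by have := rat_value_poly n%:R; rewrite !rmorph_nat. Qed.

Lemma rat_value_cst c : rv (cst c) (iota c).
Proof. by have := rat_value_poly c%:MP; rewrite mmapC. Qed.

Lemma rat_value_var i : rv (Xvar R i) (v i).
Proof. by have := rat_value_poly 'X_i; rewrite mmapX mmap1U. Qed.

Lemma rat_valueD f g w z : rv f w -> rv g z -> rv (f + g) (w + z).
Proof.
move=> [p [q [-> qn ->]]] [p' [q' [-> q'n ->]]].
exists (p * q' + p' * q), (q * q').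
by rewrite !(rmorphD, rmorphM) /= mulf_neq0 // -!addf_div ?rat_value_den_neq0.
Qed.

Lemma rat_valueM f g w z : rv f w -> rv g z -> rv (f * g) (w * z).
Proof.
move=> [p [q [-> qn ->]]] [p' [q' [-> q'n ->]]].
by exists (p * p'), (q * q'); rewrite !rmorphM /= mulf_neq0 // -!mulf_div.
Qed.

Lemma rat_valueV f w : w != 0 -> rv f w -> rv f^-1 w^-1.
Proof.
move=> wn [p [q [-> qn e]]]; exists q, p; rewrite e !invf_div; split=> //.
by apply: contraNneq wn => p0; rewrite e p0 mul0r.
Qed.

Lemma rat_valueX f w n : rv f w -> rv (f ^+ n) (w ^+ n).
Proof.
move=> h; elim: n => [|n IHn]; first exact: (rat_value_nat 1).
by rewrite !exprS; apply: rat_valueM.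
Qed.

Lemma rat_valueXz f w (m : int) : w != 0 -> rv f w -> rv (f ^ m) (w ^ m).
Proof.
move=> wn h; case: m => n; first exact: rat_valueX.
rewrite !NegzE -!exprnN.
by apply: rat_valueV; [rewrite expf_neq0|apply: rat_valueX].
Qed.

End RatValue.

(** Rational functions are evaluated at points of the function field along the
    embedding of the constants, as a ring morphism. *)
HB.instance Definition _ (R : realType) := GRing.RMorphism.copy (@cst R)
  ((@tofrac _ : {mpoly (complex R)[6]} -> ratfun R) \o @mpolyC 6 (complex R)).

(** * Positive rational functions *)

Section Positivity.
Variable R : realType.
Local Notation C := (complex R).
Local Notation K := (ratfun R).
Implicit Types f g h : K.

Lemma Xvar_neq0 i : Xvar R i != 0.
Proof.
rewrite tofrac_eq0; apply/eqP => /(congr1 (fun p => p@_U_(i)))/eqP.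
by rewrite mcoeffX mcoeff0 eqxx oner_eq0.
Qed.

Lemma character_ofD (m n : 'I_6 -> int) :
  character_of (fun i => m i + n i) (Xvar R) =
  character_of m (Xvar R) * character_of n (Xvar R).
Proof.
rewrite /character_of -big_split /=; apply: eq_bigr => i _.
by rewrite expfzDr ?Xvar_neq0.
Qed.

(** Evaluate at the point all of whose coordinates are 1: every character
    takes the value 1, and the value is the sum of the coefficients. *)
Lemma positive_comb_neq0 g : positive_comb g -> g != 0.
Proof.
move=> [s [sn sp ->]]; set g' := (X in X != 0).
have vg : rat_value (idfun : {rmorphism C -> C}) g' (fun=> 1)
    (real_complex R (\sum_(t <- s) t.1)).
  rewrite rmorph_sum /g' /=.
  elim/big_ind2: _.
  - exact: (rat_value_nat _ _ 0).
  - by move=> *; apply: rat_valueD.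
  move=> t _; rewrite -[X in rat_value _ _ _ X]mulr1; apply: rat_valueM.
    exact: rat_value_cst.
  rewrite /character_of.
  have prod1 : \prod_(i < 6) 1 ^ t.2 i = 1 :> C.
    by rewrite big1 // => i _; rewrite exp1rz.
  rewrite -[X in rat_value _ _ _ X]prod1; elim/big_ind2: _.
  - exact: (rat_value_nat _ _ 1).
  - by move=> *; apply: rat_valueM.
  - move=> i _; apply: rat_valueXz; first exact: oner_neq0.
    exact: (rat_value_var _ (fun=> 1)).
have sum_gt0 : 0 < \sum_(t <- s) t.1.
  have ge0 (r : seq (R * ('I_6 -> int))) :
      all (fun t => 0 < t.1) r -> 0 <= \sum_(t <- r) t.1.
    elim: r => [|t r IHr] /=; first by rewrite big_nil.
    by move=> /andP[t0 r0]; rewrite big_cons addr_ge0 ?IHr // ltW.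
  case: s sn sp {g' vg} => [//|t s] _ /= /andP[t0 s0].
  by rewrite big_cons ltr_wpDr ?ge0.
apply/eqP => g0; rewrite g0 in vg.
have /eqP := rat_value_inj vg (rat_value_nat _ _ 0).
by rewrite fmorph_eq0 gt_eqF.
Qed.

Lemma cst_real1 : cst (real_complex R 1) = 1 :> K.
Proof. by rewrite /cst !rmorph1. Qed.

Lemma positive_comb1 : positive_comb (1 : K).
Proof.
exists [:: (1, fun=> 0)]; split=> //=; first by rewrite ltr01.
by rewrite big_seq1 cst_real1 mul1r /character_of big1.
Qed.

Lemma positive_comb_var i : positive_comb (Xvar R i).
Proof.
exists [:: (1, fun j => (j == i)%:Z)]; split=> //=; first by rewrite ltr01.
rewrite big_seq1 cst_real1 mul1r /character_of (bigD1 i) //= eqxx expr1z.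
by rewrite big1 ?mulr1 // => j /negbTE ->; rewrite expr0z.
Qed.

Lemma positive_combD g h :
  positive_comb g -> positive_comb h -> positive_comb (g + h).
Proof.
move=> [s [sn sp ->]] [t [tn tp ->]]; exists (s ++ t).
by rewrite size_cat all_cat sp tp big_cat addn_gt0 sn.
Qed.

Lemma positive_combM g h :
  positive_comb g -> positive_comb h -> positive_comb (g * h).
Proof.
move=> [s [sn sp ->]] [t [tn tp ->]].
exists [seq (a.1 * b.1, fun i => a.2 i + b.2 i) | a <- s, b <- t]; split.
- by rewrite size_allpairs muln_gt0 sn.
- elim: s sp {sn} => [//|a s IHs] /= /andP[a0 s0]; rewrite all_cat IHs // andbT.
  by elim: t tp {tn IHs} => [//|b t IHt] /= /andP[b0 t0]; rewrite mulr_gt0 ?IHt.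
rewrite big_allpairs_dep mulr_suml; apply: eq_bigr => a _.
rewrite mulr_sumr; apply: eq_bigr => b _ /=.
by rewrite character_ofD !rmorphM mulrACA.
Qed.

Lemma positive_div g h : positive_comb g -> positive_comb h -> positive (g / h).
Proof.
move=> pg ph; split; last by exists g, h.
by rewrite mulf_neq0 ?invr_neq0 ?positive_comb_neq0.
Qed.

Lemma positive1 : positive (1 : K).
Proof. by rewrite -[1]divr1; apply: positive_div; apply: positive_comb1. Qed.

Lemma positive_var i : positive (Xvar R i).
Proof.
by rewrite -[Xvar R i]divr1; apply: positive_div;
  [apply: positive_comb_var | apply: positive_comb1].
Qed.

Lemma positiveD f g : positive f -> positive g -> positive (f + g).
Proof.
move=> [_ [a [b [pa pb ->]]]] [_ [c [d [pc pd ->]]]].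
rewrite addf_div ?positive_comb_neq0 //; apply: positive_div.
  by apply: positive_combD; apply: positive_combM.
exact: positive_combM.
Qed.

Lemma positiveM f g : positive f -> positive g -> positive (f * g).
Proof.
move=> [_ [a [b [pa pb ->]]]] [_ [c [d [pc pd ->]]]].
by rewrite mulf_div; apply: positive_div; apply: positive_combM.
Qed.

Lemma positiveV f : positive f -> positive f^-1.
Proof.
by move=> [_ [a [b [pa pb ->]]]]; rewrite invf_div; apply: positive_div.
Qed.

Lemma positiveX f n : positive f -> positive (f ^+ n).
Proof.
move=> pf; elim: n => [|n IHn]; first exact: positive1.
by rewrite exprS; apply: positiveM.
Qed.

Lemma positiveXz f (m : int) : positive f -> positive (f ^ m).
Proof.
move=> pf; case: m => n; first exact: positiveX.
by rewrite NegzE -exprnN; apply/positiveV/positiveX.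
Qed.

Lemma positive_nat n : positive (n.+1%:R : K).
Proof.
elim: n => [|n IHn]; first exact: positive1.
by rewrite -natr1; apply: positiveD => //; apply: positive1.
Qed.

Lemma positive_mapP (phi : 'I_6 -> K) :
  (forall i, positive (phi i)) -> positive_map phi.
Proof.
move=> pphi m; rewrite /character_of; apply: (big_ind (@positive R)) => //.
- exact: positive1.
- exact: positiveM.
- by move=> i _; apply: positiveXz.
Qed.

End Positivity.

(** * Substitution into subtraction-free expressions *)

Section Substitution.
Variable R : realType.
Local Notation K := (ratfun R).
Variable psi : 'I_6 -> K.
Hypothesis psi_pos : forall i, positive (psi i).

(** The relation f(psi) = w, restricted to positive f and w.  It is stable
    under sums, products and inverses, hence holds between any
    subtraction-free expression in the variables and the same expression in
    psi, denominators never vanishing. *)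
Definition positive_subst (f w : K) : Prop :=
  [/\ positive f, positive w & rat_value (@cst R) f psi w].

Lemma positive_subst_var i : positive_subst (Xvar R i) (psi i).
Proof. by split; [apply: positive_var| |apply: rat_value_var]. Qed.

Lemma positive_subst_nat n : positive_subst n.+1%:R n.+1%:R.
Proof.
by split; [exact: positive_nat|exact: positive_nat|exact: rat_value_nat].
Qed.

Lemma positive_substD f g w z : positive_subst f w -> positive_subst g z ->
  positive_subst (f + g) (w + z).
Proof.
move=> [pf pw h] [pg pz k].
by split; [apply: positiveD|apply: positiveD|apply: rat_valueD].
Qed.

Lemma positive_substM f g w z : positive_subst f w -> positive_subst g z ->
  positive_subst (f * g) (w * z).
Proof.
move=> [pf pw h] [pg pz k].
by split; [apply: positiveM|apply: positiveM|apply: rat_valueM].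
Qed.

Lemma positive_substX f w n :
  positive_subst f w -> positive_subst (f ^+ n) (w ^+ n).
Proof.
move=> [pf pw h].
by split; [apply: positiveX|apply: positiveX|apply: rat_valueX].
Qed.

Lemma positive_substV f w : positive_subst f w -> positive_subst f^-1 w^-1.
Proof.
move=> [pf pw h]; split; [exact: positiveV|exact: positiveV|].
by apply: rat_valueV => //; case: pw.
Qed.

Local Ltac subtraction_free := repeat lazymatch goal with
  | |- positive_subst (_ + _) _ => apply: positive_substD
  | |- positive_subst (_ * _) _ => apply: positive_substM
  | |- positive_subst (_ ^-1) _ => apply: positive_substV
  | |- positive_subst (_ ^+ _) _ => apply: positive_substX
  | |- positive_subst (Xvar _ _) _ => apply: positive_subst_var
  | |- positive_subst (_ *+ _) _ => apply: positive_subst_nat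
  | |- positive_subst 1 _ => exact: (positive_subst_nat 0)
  end.

Lemma positive_subst_sigma i : positive_subst (sigma (Xvar R) i) (sigma psi i).
Proof.
case: i => [[|[|[|[|[|[|//]]]]]] ip].
all: rewrite /sigma /tnth /= /a_sol /polP /polQ /polR /polS.
all: subtraction_free.
Qed.

Lemma positive_subst_tau i : positive_subst (tau (Xvar R) i) (tau psi i).
Proof.
case: i => [[|[|[|[|[|[|//]]]]]] ip].
all: rewrite /tau /tnth /= /polT /polU /polV /polW.
all: subtraction_free.
Qed.

End Substitution.

(** * Sigma and tau over the function field *)

Section Generic.
Variable R : realType.
Local Notation C := (complex R).
Local Notation K := (ratfun R).
Local Notation X := (Xvar R).

Lemma positive_torus (phi : 'I_6 -> K) :
  (forall i, positive (phi i)) -> torus phi.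
Proof. by move=> p i; case: (p i). Qed.

Lemma sigma_pos (psi : 'I_6 -> K) : (forall i, positive (psi i)) ->
  forall i, positive (sigma psi i).
Proof. by move=> p i; case: (positive_subst_sigma p i). Qed.

Lemma tau_pos (psi : 'I_6 -> K) : (forall i, positive (psi i)) ->
  forall i, positive (tau psi i).
Proof. by move=> p i; case: (positive_subst_tau p i). Qed.

Lemma ratfun_two_neq0 : 2 != 0 :> K.
Proof. by case: (@positive_nat R 1). Qed.

Local Ltac positive_tac := repeat lazymatch goal with
  | |- positive (_ + _) => apply: positiveD
  | |- positive (_ * _) => apply: positiveM
  | |- positive (_ ^-1) => apply: positiveV
  | |- positive (_ ^+ _) => apply: positiveX
  | |- positive 1 => apply: positive1
  | H : (forall i, positive (?x i)) |- positive (?x _) => apply: H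
  end.

Lemma V2_scaled_inj_pos (x y y' : 'I_6 -> K) (a a' : K) :
  (forall i, positive (x i)) -> torus y -> torus y' ->
  V2 y = a *: V1 x -> V2 y' = a' *: V1 x -> a = a' /\ y =1 y'.
Proof.
move=> xp yn yn'; have xn := positive_torus xp.
move=> e e'; have nz (f : K) : positive f -> f != 0 by case.
apply: (V2_scaled_inj ratfun_two_neq0 xn yn yn' _ _ e e').
  rewrite (V1E ratfun_two_neq0 xn) mxE /=.
  by apply: nz; positive_tac.
rewrite (V1E ratfun_two_neq0 xn) !mxE /= -subr_eq0 addrK.
by apply: nz; positive_tac.
Qed.

(** Both steps are dilations, so V1 (tau (sigma X)) = c V1 X.  The image of V1
    meets each line through 0 in at most one nonzero point, because the
    coefficient of v_1bar in V1(x) is the square of that of the empty vector;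
    hence c = 1, and V1 is injective. *)
Lemma tau_sigma_id : tau (sigma X) =1 X.
Proof.
have sp := sigma_pos (@positive_var R); have tp := tau_pos sp.
have xn := positive_torus (@positive_var R).
have [sn tn] := conj (positive_torus sp) (positive_torus tp).
have e := tau_solves ratfun_two_neq0 sn tn.
rewrite (sigma_solves ratfun_two_neq0 xn sn) scalerA in e.
set c := _ * _ in e.
have c1 : c = 1.
  have := e; rewrite (V1E ratfun_two_neq0 xn) (V1E ratfun_two_neq0 tn) /=.
  rewrite scale_col8; move=> /col8_inj[_ [eE _ _ e1]]; rewrite eE exprMn in e1.
  have cn : c != 0.
    by have := tn c0; apply: contraNneq; rewrite eE => ->; rewrite mul0r.
  apply: (mulfI cn); rewrite mulr1.
  exact: (mulIf (expf_neq0 2 (xn c0))).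
by apply: (V1_inj ratfun_two_neq0 tn xn); rewrite e c1 scale1r.
Qed.

(** Both X and sigma (tau X) solve V2(y) = a V1(x) for x = tau X. *)
Lemma sigma_tau_id : sigma (tau X) =1 X.
Proof.
have tp := tau_pos (@positive_var R); have sp := sigma_pos tp.
have xn := positive_torus (@positive_var R).
have [sn tn] := conj (positive_torus sp) (positive_torus tp).
have e := tau_solves ratfun_two_neq0 xn tn.
have e' : V2 X = (tau X c0 / X c0)^-1 *: V1 (tau X).
  by rewrite e scalerK // (mulf_neq0 (tn c0)) // invr_neq0 ?(xn c0).
exact: (V2_scaled_inj_pos tp sn xn (sigma_solves ratfun_two_neq0 tn sn) e').2.
Qed.

Section VectorValues.
Variables (F : fieldType) (iota : {rmorphism C -> F}) (v x : 'I_6 -> F).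
Variable phi : 'I_6 -> K.
Hypotheses (two_neq0 : 2 != 0 :> F) (phin : torus phi) (xn : torus x).
Hypothesis phiE : forall i, rat_value iota (phi i) v (x i).

Local Ltac rat_value_tac := repeat lazymatch goal with
  | |- rat_value _ (_ + _) _ _ => apply: rat_valueD
  | |- rat_value _ (_ * _) _ _ => apply: rat_valueM
  | |- rat_value _ (_ ^-1) _ _ =>
      apply: rat_valueV;
        first by rewrite ?(mulf_neq0, expf_neq0, two_neq0) // xn
  | |- rat_value _ (_ ^+ _) _ _ => apply: rat_valueX
  | |- rat_value _ (_ *+ _) _ _ => exact: rat_value_nat
  | |- rat_value _ 1 _ _ => exact: (rat_value_nat _ _ 1)
  | |- rat_value _ (phi _) _ _ => exact: phiE
  end.

Lemma rat_value_V1 j : rat_value iota (V1 phi j 0) v (V1 x j 0).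
Proof.
rewrite (V1E ratfun_two_neq0 phin) (V1E two_neq0 xn) !mxE.
by case: j => [[|[|[|[|[|[|[|[|//]]]]]]]] jp] /=; rat_value_tac.
Qed.

Lemma rat_value_V2 j : rat_value iota (V2 phi j 0) v (V2 x j 0).
Proof.
rewrite (V2E ratfun_two_neq0 phin) (V2E two_neq0 xn) !mxE.
by case: j => [[|[|[|[|[|[|[|[|//]]]]]]]] jp] /=; rat_value_tac.
Qed.

End VectorValues.

Lemma complex_two_neq0 : 2 != 0 :> C.
Proof. by rewrite pnatr_eq0. Qed.

(** The vector V1(x) attached to V2(y) by tau is a multiple of V2(y), and the
    multiplier is forced by the relation between the last and the fifth
    coefficient of V1(x).  So V1(x) depends on the vector V2(y) only, even
    where several y give the same vector. *)
Lemma tau_graph_dilation w w' : param_graph (@V2 C) (@V1 C) (tau X) w w' ->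
  w' = (w bv1b 0 / w bvE 0 ^+ 2) *: w.
Proof.
move=> [y [x [yn xn -> -> h]]].
have Xn := positive_torus (@positive_var R).
have tn := positive_torus (tau_pos (@positive_var R)).
have {}h i : rat_value (idfun : {rmorphism C -> C}) (tau X i) y (x i).
  exact: h.
have e : V1 x = (x c0 / y c0) *: V2 y.
  apply/colP => j; rewrite [RHS]mxE.
  apply: (rat_value_inj (rat_value_V1 complex_two_neq0 tn xn h j)).
  rewrite (tau_solves ratfun_two_neq0 Xn tn) [X in rat_value _ X]mxE.
  apply: rat_valueM.
    apply: rat_valueM; first exact: h.
    by apply: rat_valueV; [exact: yn | exact: rat_value_var].
  by apply: (rat_value_V2 complex_two_neq0 Xn yn) => i; apply: rat_value_var.
rewrite e; congr (_ *: _); move: e.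
rewrite (V1E complex_two_neq0 xn) (V2E complex_two_neq0 yn) /=.
rewrite scale_col8 !mxE /=.
move=> /col8_inj[_ [_ _ _ e1]].
have cn : x c0 / y c0 != 0 by rewrite mulf_neq0 ?invr_neq0.
by apply: (mulfI cn); rewrite [RHS]mulrA -e1; field.
Qed.

End Generic.

Theorem proposition4p2 (R : realType) :
  [/\ (forall (a : ratfun R) (y : 'I_6 -> ratfun R),
         (torus y /\ V2 y = a *: V1 (Xvar R)) <->
         (a = a_sol (Xvar R) /\ y =1 sigma (Xvar R))),
      birational_pair (@V1 (complex R)) (@V2 (complex R))
        (sigma (Xvar R)) (tau (Xvar R)),
      positive_map (sigma (Xvar R)) &
      positive_map (tau (Xvar R))].
Proof.
have Xp := @positive_var R; have sp := sigma_pos Xp; have tp := tau_pos Xp.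
have Xn := positive_torus Xp.
have [sn tn] := conj (positive_torus sp) (positive_torus tp).
have sE := sigma_solves (ratfun_two_neq0 R) Xn sn.
split; [|split| |].
- move=> a y; split=> [[yn yE]|[-> /funext ->]]; last exact: (conj sn sE).
  exact: (V2_scaled_inj_pos Xp yn sn yE sE).
- split; first exact: sn.
  (* V1 is injective on the whole torus, so x is determined by the point. *)
  move=> w w1 w2 [x [y [xn yn -> -> h]]] [x' [y' [xn' yn' e -> h']]].
  have /funext xE := V1_inj (complex_two_neq0 R) xn xn' e.
  congr V2; apply: funext => i; rewrite xE in h.
  exact: (rat_value_inj (iota := idfun) (h i) (h' i)).
- split; first exact: tn.
  by move=> w w1 w2 /tau_graph_dilation -> /tau_graph_dilation ->.
- by move=> i; have [_ _] := positive_subst_tau sp i; rewrite tau_sigma_id.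
- by move=> i; have [_ _] := positive_subst_sigma tp i; rewrite sigma_tau_id.
- exact: positive_mapP.
- exact: positive_mapP.
Qed.
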